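(* Let $X$ be a Hausdorff space, let $\tau^c$ be the family of all closed subsets of $X$ and $\mathcal C_X$ the family of all compact subsets of $X$. Let $Y$ be a Hausdorff space with a strictly increasing closed cover $\{B_n\}_{n\in\mathbb N}$. Then $X$ is strongly quasi-metrizable if and only if there exists a map $\phi:\tau^c\to\mathcal L(X,\mathcal F(Y))$, $F\mapsto\phi_F$, such that: (i) for each $F\in\tau^c$, $F=\bigcap_{n\in\mathbb N}\phi_F^{-1}[Y\setminus B_n]$; (ii) if $F_1,F_2\in\tau^c$ and $F_1\subset F_2$, then $\phi_{F_1}(x)\subset\phi_{F_2}(x)$ for all $x\in X$; (iii) for each $K\in\mathcal C_X$ and $F\in\tau^c$ with $K\cap F=\emptyset$, $\phi_K$ is bounded on $F$.
   Context: $\mathbb N$ is the set of positive integers. A sequence $\{B_n\}_{n\in\mathbb N}$ of closed subsets of a space $Y$ is a strictly increasing closed cover of $Y$ if $Y=\bigcup_{n}B_n$, $B_1\neq\emptyset$ and $B_n\subsetneq B_{n+1}$ for each $n$. $\mathcal F(Y)$ is the family of nonempty closed subsets of $Y$. For a set-valued map $\psi:X\to\mathcal F(Y)$ and $B\subset Y$, $\psi^{-1}[B]=\{x\in X:\psi(x)\cap B\neq\emptyset\}$ and $\psi^{\#}[B]=\{x\in X:\psi(x)\subset B\}$. $\psi$ is lower semi-continuous if $\psi^{-1}[V]$ is open in $X$ for each open $V\subset Y$; $\mathcal L(X,\mathcal F(Y))$ is the set of all lower semi-continuous maps $X\to\mathcal F(Y)$. $\psi$ is bounded on $A\subset X$ if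 $A\subset\psi^{\#}[B_n]$ for some $n\in\mathbb N$. Since $X$ is Hausdorff, compact subsets are closed, so $\phi_K$ makes sense for $K\in\mathcal C_X$. A quasi-metric on $X$ is a function $d:X\times X\to[0,\infty)$ such that $d(x,y)=0$ if and only if $x=y$, and $d(x,z)\le d(x,y)+d(y,z)$ for all $x,y,z\in X$. Then $d^{-1}(x,y)=d(y,x)$ is also a quasi-metric. For a quasi-metric $d$, $\tau_d$ is the topology on $X$ with base $\{B_d(x,r):x\in X,r>0\}$, where $B_d(x,r)=\{y\in X:d(x,y)<r\}$; $\tau_{d^{-1}}$ is defined likewise from $d^{-1}$. $d$ is a strong quasi-metric if $\tau_d\subset\tau_{d^{-1}}$. A space $(X,\tau)$ is strongly quasi-metrizable if there is a strong quasi-metric $d$ on $X$ with $\tau=\tau_d$. *)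

(* Defs.v *)
From mathcomp Require Import all_boot all_order all_algebra.
From mathcomp Require Import all_classical all_reals.
From mathcomp Require Import topology.

Set Implicit Arguments.
Unset Strict Implicit.
Unset Printing Implicit Defensive.

Import Order.TTheory GRing.Theory Num.Theory.

Local Open Scope classical_set_scope.
Local Open Scope ring_scope.

Definition quasi_metric (R : realType) (X : Type) (d : X -> X -> R) : Prop :=
  [/\ forall x y, 0 <= d x y,
      forall x y, d x y = 0 <-> x = y
    & forall x y z, d x z <= d x y + d y z].

Definition qm_inv (R : realType) (X : Type) (d : X -> X -> R) : X -> X -> R :=
  fun x y => d y x.

Definition qm_ball (R : realType) (X : Type) (d : X -> X -> R)
  (x : X) (r : R) : set X := [set y | d x y < r].

(* The open sets of tau_d: arbitrary unions of balls of positive radius. *)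
Definition qm_topology (R : realType) (X : Type) (d : X -> X -> R) :
  set_system X :=
  [set \bigcup_(p in D) qm_ball d p.1 p.2 |
    D in [set D : set (X * R) | forall p, D p -> 0 < p.2]].

Definition strong_quasi_metric (R : realType) (X : Type) (d : X -> X -> R) :
  Prop := quasi_metric d /\ qm_topology d `<=` qm_topology (qm_inv d).

Definition strongly_quasi_metrizable (R : realType) (X : topologicalType) :
  Prop :=
  exists d : X -> X -> R, strong_quasi_metric d /\ @open X = qm_topology d.

(* Indices are shifted by one: [B n] for n : nat is the set B_{n+1}. *)
Definition strictly_increasing_closed_cover (Y : topologicalType)
  (B : nat -> set Y) : Prop :=
  [/\ forall n, closed (B n),
      \bigcup_n B n = setT,
      B 0%N !=set0
    & forall n, B n `<` B n.+1].

Definition nonempty_closed (Y : topologicalType) : set (set Y) :=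
  [set A | A !=set0 /\ closed A].

Definition sv_preimage (X Y : Type) (psi : X -> set Y) (A : set Y) : set X :=
  [set x | psi x `&` A !=set0].

Definition sv_core (X Y : Type) (psi : X -> set Y) (A : set Y) : set X :=
  [set x | psi x `<=` A].

Definition lsc_maps (X Y : topologicalType) : set (X -> set Y) :=
  [set psi | (forall x, nonempty_closed (psi x)) /\
             (forall V : set Y, open V -> open (sv_preimage psi V))].
Arguments lsc_maps : clear implicits.

Definition sv_bounded_on (X Y : Type) (B : nat -> set Y) (psi : X -> set Y)
  (A : set X) : Prop := exists n, A `<=` sv_core psi (B n).

(* Main.v *)
Require Import Defs.
From mathcomp Require Import all_boot all_order all_algebra.
From mathcomp Require Import all_classical all_reals.
From mathcomp Require Import topology.
From mathcomp Require Import lra.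

Set Implicit Arguments.
Unset Strict Implicit.
Unset Printing Implicit Defensive.

Local Open Scope classical_set_scope.

(** A map [phi] as in the theorem carries the same information as the
    open sets [U n F = sv_preimage (phi F) (~` B n)]: they decrease in [n],
    increase in [F], have intersection [F], and some [U n K] misses [F] when the
    compact set [K] does ([expansion]).  Conversely, given such [U], the
    intersection of the [B n] with [x] outside [U n F] is a suitable [phi F x]
    ([lsc_of_expansion], [expansion_of_lsc]); so the theorem says that [X] has
    an expansion iff it is strongly quasi-metrizable.

    From a strong quasi-metric one takes for [U n F] the union of the balls of
    radius [2^-n] centred in [F].  That their intersection is [F] is where
    strength enters: if [d x_n p] tends to 0 with [x_n] in [F], then [x_n] tends
    to [p] for the conjugate topology, which is finer than that of [X].

    For the converse let [g n x = U n [set x]].  Two facts about [g] follow.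
    Since [U n F] shrinks to [F], if [p] lies in [g n x] for a large [n] then [x]
    is close to [p] ([g_conv]).  Applying the condition on compact sets to a
    sequence converging to [p], together with [p], the set reached from [p] in
    two steps of [g n], hence in any fixed number of steps, is small when [n] is
    large ([g_gamma], [chain_g_base]).

    A quasi-metric is obtained from relations [W n] with
    [W n.+1 o W n.+1 o W n.+1] inside [W n] by minimising the weight of chains
    ([normal_sequence_metrizable]).  Such [W] exist as soon as there are
    neighbourhood relations [V n] for which both [V] and its inverse satisfy a
    pointwise three-step condition ([bilocal_metrizable]); this is the
    Niemytzki-Wilson argument, in the asymmetric form due to Fox.  The forward
    condition holds for relations contained in a fixed number of steps of [g],
    but the inverse condition may fail for [g] itself: a chain
    [a -> b -> x] with [b] close to [x] says nothing about [a].

    The remedy is to assign neighbourhoods to classes of points; the outcome is an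
    instance of Junnila's theorem that developable gamma-spaces are
    quasi-metrizable, with a strong quasi-metric.  For each
    [n] one finds a map [D] with [D a] a neighbourhood of [a] reached in two
    steps of [g n], whose level sets decompose, countably often, into discrete
    families of closed sets ([sigma_discrete], [g_partition]).  Steps of [V m]
    are required to stay inside [D a] and, for the first [m] pieces [Z], to
    arrive in [Z] only from points of [Z] with the same value of [D].  If [x]
    belongs to [Z], then every chain of steps ending at [x] starts at a point [a]
    with [D a = D x], so that [x] is in [D a]: the inverse condition holds for
    chains of any length. *)

(** * Quasi-metrics from chains *)

Section ChainQuasiMetric.
Import Order.TTheory GRing.Theory Num.Theory.
Local Open Scope ring_scope.
Variables (R : realType) (X : Type) (W : nat -> X -> X -> Prop).

Fixpoint chain (s : seq nat) (a b : X) : Prop :=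
  if s is i :: t then exists2 c, W i a c & chain t c b else a = b.

Definition weight (s : seq nat) : R := \sum_(i <- s) 2^-1 ^+ i.

Definition chain_dist (a b : X) : R := inf [set weight s | s in chain^~ a ^~ b].

Lemma weight_cons i s : weight (i :: s) = 2^-1 ^+ i + weight s.
Proof. by rewrite /weight big_cons. Qed.

Lemma weight_ge0 s : 0 <= weight s.
Proof. by apply: sumr_ge0 => i _; rewrite exprn_ge0// invr_ge0. Qed.

Lemma half_expr_gt0 n : 0 < 2^-1 ^+ n :> R.
Proof. by rewrite exprn_gt0// invr_gt0. Qed.

Lemma half_expr_le m n : (m <= n)%N -> 2^-1 ^+ n <= 2^-1 ^+ m :> R.
Proof.
by move=> mn; apply: ler_wiXn2l => //; [rewrite invr_ge0|rewrite invf_le1// ler1n].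
Qed.

Lemma chain_cat s t a b c : chain s a b -> chain t b c -> chain (s ++ t) a c.
Proof.
elim: s a => [|i s IH] a /=; first by move=> ->.
by move=> [x Wx sx] tb; exists x => //; exact: IH.
Qed.

Lemma chain_split s t a c : chain (s ++ t) a c ->
  exists2 b, chain s a b & chain t b c.
Proof.
elim: s a => [|i s IH] a /=; first by exists a.
by move=> [x Wx /IH[b sb tb]]; exists b => //; exists x.
Qed.

(** A chain of weight less than [g + h] can be cut at one link into a part of
    weight less than [g] and a part of weight less than [h]: the link is the
    first one after which less than [h] remains. *)
Lemma weight_split s (g h : R) : s != [::] -> 0 < g -> 0 < h ->
  weight s < g + h ->
  exists s1 i s2, [/\ s = s1 ++ i :: s2, weight s1 < g & weight s2 < h].
Proof.
elim: s g => // i s IH g _ g0 h0; rewrite weight_cons => sgh.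
have [sh|hs] := ltP (weight s) h.
  by exists [::], i, s; split=> //; rewrite /weight big_nil.
have i0 := half_expr_gt0 i.
have s0 : s != [::].
  by apply/eqP => s0; move: hs; rewrite s0 /weight big_nil leNgt h0.
have gi0 : 0 < g - 2^-1 ^+ i by lra.
have sgi : weight s < g - 2^-1 ^+ i + h by lra.
have [s1 [j [s2 [-> s1g s2h]]]] := IH _ s0 gi0 h0 sgi.
by exists (i :: s1), j, s2; split=> //; rewrite weight_cons; lra.
Qed.

Hypothesis Wxx : forall n a, W n a a.
Hypothesis W3 : forall n a b c e,
  W n.+1 a b -> W n.+1 b c -> W n.+1 c e -> W n a e.

Lemma W_anti m n a b : (m <= n)%N -> W n a b -> W m a b.
Proof.
move=> /subnK <-; elim: (n - m)%N => // k IH Wab.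
by apply: IH; exact: (W3 (Wxx _ _) Wab (Wxx _ _)).
Qed.

(** The chain lemma, by induction on the length: cutting at the middle of the
    weight leaves two shorter chains of weight less than [2^-(n+1)] and a link of
    index at least [n.+1], so that three steps of [W n.+1] suffice. *)
Lemma chain_weight_lt s n a b : chain s a b -> weight s < 2^-1 ^+ n -> W n a b.
Proof.
have [k] := ubnP (size s); elim: k s n a b => // k IH s n a b sk sab sn.
have [s0|s0] := eqVneq s [::]; first by move: sab; rewrite s0 /= => ->.
have hn := half_expr_gt0 n.+1.
have sn' : weight s < 2^-1 ^+ n.+1 + 2^-1 ^+ n.+1.
  by move: sn; rewrite exprS; lra.
have [s1 [i [s2 [es s1n s2n]]]] := weight_split s0 hn hn sn'.
move: sab sk; rewrite es => /chain_split[x s1x /= [y Wxy s2y]].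
rewrite size_cat /= addnS ltnS => sk.
have ni : (n < i)%N.
  rewrite ltnNge; apply/negP => iin.
  move: sn; apply/negP; rewrite -leNgt es /weight big_cat big_cons /=.
  have := half_expr_le iin.
  have := weight_ge0 s1; have := weight_ge0 s2; rewrite /weight; lra.
apply: (W3 (b := x) (c := y)).
- by apply: IH s1x s1n; apply: leq_ltn_trans sk; rewrite leq_addr.
- exact: W_anti Wxy.
- by apply: IH s2y s2n; apply: leq_ltn_trans sk; rewrite leq_addl.
Qed.

(* Any two points are joined by a chain, so the infimum is not over an empty
   set. *)
Hypothesis W0 : forall a b, W 0 a b.

Lemma has_inf_chain a b : has_inf [set weight s | s in chain^~ a ^~ b].
Proof.
split; first by exists (weight [:: 0%N]), [:: 0%N] => //=; exists b.
by exists 0 => _ [s _ <-]; exact: weight_ge0.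
Qed.

Lemma chain_dist_le s a b : chain s a b -> chain_dist a b <= weight s.
Proof.
by move=> sab; apply: ge_inf; [case: (has_inf_chain a b)|exists s].
Qed.

Lemma chain_dist_lt a b r : chain_dist a b < r ->
  exists2 s, chain s a b & weight s < r.
Proof.
rewrite -subr_gt0 => /(inf_adherent)/(_ (has_inf_chain a b))[_ [s sab <-]].
by rewrite -/(chain_dist a b) addrC subrK; exists s.
Qed.

Lemma chain_dist_ge0 a b : 0 <= chain_dist a b.
Proof.
by apply: lb_le_inf; [case: (has_inf_chain a b)|move=> _ [s _ <-]; exact: weight_ge0].
Qed.

Lemma chain_dist_triangle a b c :
  chain_dist a c <= chain_dist a b + chain_dist b c.
Proof.
apply/ler_addgt0Pr => e e0.
have [|s sab sw] := @chain_dist_lt a b (chain_dist a b + e / 2); first lra.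
have [|t tbc tw] := @chain_dist_lt b c (chain_dist b c + e / 2); first lra.
have := chain_dist_le (chain_cat sab tbc).
by rewrite /weight big_cat /= -/(weight s) -/(weight t); lra.
Qed.

Lemma chain_distxx a : chain_dist a a = 0.
Proof.
apply/eqP; rewrite eq_le chain_dist_ge0 andbT.
by have := @chain_dist_le [::] a a erefl; rewrite /weight big_nil.
Qed.

Lemma chain_dist_leW n a b : W n a b -> chain_dist a b <= 2^-1 ^+ n.
Proof.
move=> Wab; have := @chain_dist_le [:: n] a b.
by rewrite /weight big_seq1; apply; exists b.
Qed.

Lemma chain_dist_ltW n a b : chain_dist a b < 2^-1 ^+ n -> W n a b.
Proof. by move=> /chain_dist_lt[s sab]; exact: chain_weight_lt. Qed.

End ChainQuasiMetric.

(** * Topologies of quasi-metrics *)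

Section QuasiMetricTopology.
Import Order.TTheory GRing.Theory Num.Theory.
Local Open Scope ring_scope.

Lemma quasi_metric_inv (R : realType) (X : Type) (d : X -> X -> R) :
  quasi_metric d -> quasi_metric (qm_inv d).
Proof.
move=> [d0 dxy dT]; split=> [x y|x y|x y z]; rewrite /qm_inv //.
  by split=> [/dxy|->]; last exact/dxy.
by rewrite addrC; exact: dT.
Qed.

Lemma qm_topologyP (R : realType) (X : Type) (d : X -> X -> R) (A : set X) :
  quasi_metric d ->
  qm_topology d A <-> forall x, A x -> exists2 r, 0 < r & qm_ball d x r `<=` A.
Proof.
move=> [d0 dxy dT]; split=> [[D D0 <-] x [[y r] Dyr /= dyx]|Aball].
  exists (r - d y x); first by rewrite subr_gt0.
  move=> z; rewrite /qm_ball /= => dxz; exists (y, r) => //=.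
  by rewrite /qm_ball /=; have := dT y x z; lra.
exists [set p : X * R | 0 < p.2 /\ qm_ball d p.1 p.2 `<=` A].
  by move=> p [].
apply/seteqP; split=> [x [p [_ +]]|x Ax]; first exact.
have [r r0 xrA] := Aball x Ax; exists (x, r) => //=.
by rewrite /qm_ball /= (dxy x x).2.
Qed.

Lemma half_expr_lt (R : realType) (r : R) : 0 < r -> exists n, 2^-1 ^+ n < r.
Proof.
move=> r0; have [n] := ltr_add_invr r0.
rewrite add0r => nr; exists n; apply: le_lt_trans nr.
rewrite exprVn lef_pV2 ?posrE ?exprn_gt0 ?ltr0n//.
by rewrite -natrX ler_nat ltn_expl.
Qed.

(** The quasi-metric is the chain distance.  The conditions on [W n x] and on
    its converse give, respectively, the topology of [X] and the strength. *)
Lemma normal_sequence_metrizable (R : realType) (X : topologicalType)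
    (W : nat -> X -> X -> Prop) :
  accessible_space X ->
  (forall a b, W 0 a b) ->
  (forall n x, nbhs x (W n x)) ->
  (forall n a b c e, W n.+1 a b -> W n.+1 b c -> W n.+1 c e -> W n a e) ->
  (forall x A, nbhs x A -> exists n, W n x `<=` A) ->
  (forall x A, nbhs x A -> exists n, (W n)^~ x `<=` A) ->
  strongly_quasi_metrizable R X.
Proof.
move=> X1 W0 Wnbhs W3 Wbase Wbase'.
have Wxx n a : W n a a by exact: nbhs_singleton (Wnbhs n a).
pose d : X -> X -> R := chain_dist R W.
have dW n a b : d a b < 2^-1 ^+ n -> W n a b by exact: chain_dist_ltW.
have qd : quasi_metric d.
  split=> [a b|a b|a b c]; first exact: chain_dist_ge0.
  - split=> [dab|->]; last exact: chain_distxx.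
    apply: contrapT => /eqP /X1[A [oA [/set_mem Aa /set_mem nAb]]].
    have [n WA] := Wbase a A (open_nbhs_nbhs (conj oA Aa)).
    by apply: nAb; apply: WA; apply: dW; rewrite dab half_expr_gt0.
  - exact: chain_dist_triangle.
have openP A : open A <-> qm_topology d A.
  rewrite qm_topologyP //; split=> [oA x Ax|Aball].
    have [n WA] := Wbase x A (open_nbhs_nbhs (conj oA Ax)).
    exists (2^-1 ^+ n); first exact: half_expr_gt0.
    by move=> y /dW; exact: WA.
  rewrite openE => x /Aball[r /half_expr_lt[n nr] rA].
  apply: filterS (Wnbhs n x) => y Wxy; apply: rA.
  by rewrite /qm_ball /=; apply: le_lt_trans nr; exact: chain_dist_leW.
exists d; split; last by apply/funext => A; apply/propext; exact: openP.
split=> // A /openP oA; apply/qm_topologyP; first exact: quasi_metric_inv.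
move=> x Ax; have [n WA] := Wbase' x A (open_nbhs_nbhs (conj oA Ax)).
exists (2^-1 ^+ n); first exact: half_expr_gt0.
by move=> y /dW; exact: WA.
Qed.

End QuasiMetricTopology.

(** The hypotheses [Vlocal] and [Vcolocal] are pointwise: the index [n] depends
    on [x].  Passing to an inclusion that is uniform in [x] is the whole
    difficulty. *)
Section BiLocal.
Variables (X : topologicalType) (V : nat -> X -> X -> Prop).
Hypothesis V0 : forall a b, V 0 a b.
Hypothesis Vnbhs : forall n x, nbhs x (V n x).
Hypothesis V_anti : forall m n a b, m <= n -> V n a b -> V m a b.
Hypothesis Vlocal : forall x A, nbhs x A ->
  exists n, forall a b c, V n x a -> V n a b -> V n b c -> A c.
Hypothesis Vcolocal : forall x m,
  exists n, forall a b c, V n a b -> V n b c -> V n c x -> V m a x.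
Hypothesis Vconv : forall x A, nbhs x A -> exists n, (V n)^~ x `<=` A.

(** [W n a b] holds when [a -> x -> b] for some centre [x], both steps taken at
    the level [k x n] which belongs to [x].  In [a -> x -> b -> y -> c], if the
    level of [x] is the smaller one, then [x -> b -> y -> c] are three steps of
    that level, and [x] is a centre for [(a, c)] one level lower.  Otherwise
    [a -> x -> b -> y] are three steps at the level of [y], and [y] is a centre by
    the condition on inverses. *)
Lemma bilocal_metrizable (R : realType) :
  accessible_space X -> strongly_quasi_metrizable R X.
Proof.
move=> X1; have Vxx n a : V n a a by exact: nbhs_singleton (Vnbhs n a).
have /choice[next nextP] (q : X * nat) : exists n, [/\ q.2 < n,
    forall a b c, V n q.1 a -> V n a b -> V n b c -> V q.2 q.1 c
  & forall a b c, V n a b -> V n b c -> V n c q.1 -> V q.2 a q.1].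
  case: q => x m /=.
  have [n1 n1P] := Vlocal (Vnbhs m x); have [n2 n2P] := Vcolocal x m.
  exists (maxn m.+1 (maxn n1 n2)); split=> [|a b c|a b c].
  - by rewrite leq_max leqnn.
  - have n1le : n1 <= maxn m.+1 (maxn n1 n2) by rewrite !leq_max leqnn orbT.
    by move=> ? ? ?; apply: (n1P a b); exact: (V_anti n1le).
  - have n2le : n2 <= maxn m.+1 (maxn n1 n2) by rewrite !leq_max leqnn !orbT.
    by move=> ? ? ?; apply: (n2P a b c); exact: (V_anti n2le).
pose k x n := iter n (fun m => next (x, m)) 0.
have nk x n : n <= k x n.
  elim: n => // n IH; have [lt_next _ _] := nextP (x, k x n).
  exact: leq_ltn_trans IH lt_next.
pose W n a b := exists2 x, V (k x n) a x & V (k x n) x b.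
have W2 n a b c : W n.+1 a b -> W n.+1 b c -> W n a c.
  move=> [x ax xb] [y b_y yc].
  have [lx fx _] := nextP (x, k x n); have [ly _ gy] := nextP (y, k y n).
  have [kxy|/ltnW kyx] := leqP (k x n.+1) (k y n.+1).
    exists x; first exact: V_anti (ltnW lx) ax.
    exact: fx xb (V_anti kxy b_y) (V_anti kxy yc).
  exists y; last exact: V_anti (ltnW ly) yc.
  exact: gy (V_anti kyx ax) (V_anti kyx xb) b_y.
have WV n a b : W n a b -> exists2 x, V n a x & V n x b.
  by move=> [x ax xb]; exists x; exact: (V_anti (nk x n)).
have Wxx n a : W n a a by exists a.
have Wanti m n a b : m <= n -> W n a b -> W m a b.
  move=> /subnK <-; elim: (n - m) => // i IH Wab.
  by apply: IH; exact: W2 Wab (Wxx _ _).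
(* Three steps of [W n.+2] are within [W n]: hence the doubled index. *)
apply: (@normal_sequence_metrizable R X (fun n => W n.*2)) => //.
- by move=> a b; exists a; exact: V0.
- move=> n x; apply: filterS (Vnbhs (k x n.*2) x) => y Vxy.
  by exists x.
- move=> n a b c e; rewrite doubleS => ab bc ce.
  by apply: W2 (W2 _ _ _ _ ab bc) _; exact: Wanti ce.
- move=> x A /Vlocal[n nA]; exists n => y Wxy.
  have [|z xz zy] := @WV n x y; first by apply: Wanti Wxy; rewrite -addnn leq_addr.
  exact: nA xz zy (Vxx _ _).
- move=> x A /Vconv[m mA]; have [n nm] := Vcolocal x m; exists n => y Wyx.
  have [|z yz zx] := @WV n y x; first by apply: Wanti Wyx; rewrite -addnn leq_addr.
  by apply: mA; exact: nm (Vxx _ _) yz zx.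
Qed.
End BiLocal.

(** * Sigma-discrete maps and expansions *)

(** Minima for arbitrary Prop-valued predicates, from the boolean
    well-ordering principle. *)
Lemma well_order_min (X : choiceType) : exists le : X -> X -> Prop,
  (forall P : set X, P !=set0 -> exists2 w, P w & forall v, P v -> le w v) /\
  (forall v w, le v w -> le w v -> v = w).
Proof.
have [r wo_r] := wochoice.well_ordering_principle X.
have least (P : set X) : P !=set0 -> exists2 w, P w & forall v, P v -> r w v.
  move=> [x Px]; have [|w [[Pw wmin] _]] := wo_r [pred v | v \in P].
    by exists x; rewrite !inE.
  by exists w => [|v Pv]; [move: Pw; rewrite !inE|apply: wmin; rewrite !inE].
exists (fun v w => r v w); split=> [|v w vw wv]; first exact: least.
have wo_rT : wochoice.wo_chain r predT by exact: wochoice.withinW.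
by apply: (wochoice.wo_chain_antisymmetric wo_rT) => //; rewrite vw.
Qed.

Section SigmaDiscrete.
Variable X : topologicalType.

(** The neighbourhood of [b] says that the traces on [Z n] of the fibres of [c]
    form a discrete family of closed sets.  The relation
    [Z n y -> Z n b /\ c b = c y] between [b] and [y] is moreover transitive,
    which is what makes these maps useful. *)
Definition sigma_discrete (J : Type) (c : X -> J) : Prop :=
  exists Z : nat -> set X, (forall x, exists n, Z n x) /\
    forall n b, nbhs b [set y | Z n y -> Z n b /\ c b = c y].

Lemma sigma_discrete_countable (I : countType) (J : Type) (c : X -> J)
    (Z : I -> set X) :
  (forall x, exists i, Z i x) ->
  (forall i b, nbhs b [set y | Z i y -> Z i b /\ c b = c y]) ->
  sigma_discrete c.
Proof.
move=> Zcov Znbhs; exists (fun n => if unpickle n is Some i then Z i else set0).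
split=> [x|n b]; first by have [i Zi] := Zcov x; exists (pickle i); rewrite pickleK.
by case: (unpickle n) => [i|]; [exact: Znbhs|exact: filterS filterT].
Qed.

Lemma sigma_discrete_diag (J : Type) (i : X -> nat) (c : nat -> X -> J) :
  sigma_discrete i -> (forall k, sigma_discrete (c k)) ->
  sigma_discrete (fun x => c (i x) x).
Proof.
move=> [Z [Zcov Znbhs]] /choice[Z' Z'P].
pose C (p : nat * nat * nat) :=
  [set x | [/\ i x = p.1.1, Z p.1.2 x & Z' p.1.1 p.2 x]].
apply: (@sigma_discrete_countable _ _ _ C) => [x|[[k m] n] b].
  have [m Zm] := Zcov x; have [n Zn] := (Z'P (i x)).1 x.
  by exists (i x, m, n).
apply: filterS (filterI (Znbhs m b) ((Z'P k).2 n b)) => y [Zy Z'y] [/= iy Zmy Z'ny].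
have [Zb iby] := Zy Zmy; have [Z'b cby] := Z'y Z'ny.
by split=> /=; [split=> //; rewrite iby|rewrite iby iy].
Qed.

End SigmaDiscrete.

(** The properties of the sets [sv_preimage (phi F) (~` B n)], without [Y]. *)
Definition expansion (X : topologicalType) (U : nat -> set X -> set X) : Prop :=
  [/\ forall n F, closed F -> open (U n F),
      forall m n F, closed F -> m <= n -> U n F `<=` U m F,
      forall n F G, closed F -> closed G -> F `<=` G -> U n F `<=` U n G,
      forall F, closed F -> \bigcap_n U n F = F
    & forall K F, compact K -> closed F -> K `&` F = set0 ->
        exists n, U n K `&` F = set0].

Section Expansion.
Variables (X : topologicalType) (U : nat -> set X -> set X).
Hypothesis X2 : hausdorff_space X.
Hypothesis Uexp : expansion U.

Local Lemma Uopen n F : closed F -> open (U n F).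
Proof. by case: Uexp => + _ _ _ _; apply. Qed.

Local Lemma Uanti m n F : closed F -> m <= n -> U n F `<=` U m F.
Proof. by case: Uexp => _ + _ _ _; apply. Qed.

Local Lemma Umono n F G : closed F -> closed G -> F `<=` G -> U n F `<=` U n G.
Proof. by case: Uexp => _ _ + _ _; apply. Qed.

Local Lemma Ucap F : closed F -> \bigcap_n U n F = F.
Proof. by case: Uexp => _ _ _ + _; apply. Qed.

Local Lemma Ucompact K F : compact K -> closed F -> K `&` F = set0 ->
  exists n, U n K `&` F = set0.
Proof. by case: Uexp => _ _ _ _; apply. Qed.

Local Lemma Usub n F : closed F -> F `<=` U n F.
Proof. by move=> cF x; rewrite -{1}(Ucap cF); apply. Qed.

Local Lemma Uout F x : closed F -> ~ F x -> exists n, ~ U n F x.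
Proof.
move=> cF; apply: contra_notP => /forallNP UF; rewrite -(Ucap cF) => n _.
exact: contrapT.
Qed.

(** The fibre of [i] over [k] is the difference of two closed sets.  In a space
    with an expansion this is a countable union of closed sets, and countably
    many fibres of this kind raise no question of discreteness. *)
Lemma sigma_discrete_least (T : nat -> set X) (i : X -> nat) :
  (forall k, closed (T k)) ->
  (forall x, T (i x) x /\ forall k, k < i x -> ~ T k x) ->
  sigma_discrete i.
Proof.
move=> cT iT; pose L k := \bigcup_(l in `I_k) T l.
have cL k : closed (L k) by apply: closed_bigcup => // l _; exact: cT.
pose Z (p : nat * nat) := T p.1 `\` U p.2 (L p.1).
have Zi p x : Z p x -> i x = p.1.
  move=> [Tx nU]; have [Tix Tlt] := iT x.
  have [ilt|lti|//] := ltngtP (i x) p.1; last by case: (Tlt _ lti).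
  by case: nU; apply: Usub => //; exists (i x).
apply: (@sigma_discrete_countable _ _ _ _ Z) => [x|p b].
  have [Tix Tlt] := iT x.
  have [|n nU] := @Uout (L (i x)) x (cL _); last by exists (i x, n).
  by move=> [l /= /Tlt].
have [Zb|Zb] := pselect (Z p b).
  by apply: filterS filterT => y _ /= Zy; rewrite (Zi _ _ Zb) (Zi _ _ Zy).
have nZ : nbhs b (~` Z p).
  apply: open_nbhs_nbhs; split=> //; apply: closed_openC.
  by rewrite /Z setDE; apply: closedI => //; exact/open_closedC/Uopen.
by apply: filterS nZ => y nZy /nZy.
Qed.

(** Points are classified by the first member of a well-ordered open cover
    containing them, and [Z n] keeps those outside the expansion of the complement
    of that member.  Near [b], later classes are avoided by [O (w b)], and earlier
    ones by the [n]-th expansion of the closed set [H] of the points outside all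
    earlier members: it is included in the expansions of the complements of these
    members, by monotonicity. *)
Lemma sigma_discrete_first (O : X -> set X) (le : X -> X -> Prop) (w : X -> X) :
  (forall x, open (O x)) -> (forall v w, le v w -> le w v -> v = w) ->
  (forall x, O (w x) x /\ forall v, O v x -> le (w x) v) ->
  sigma_discrete w.
Proof.
move=> oO le_anti wP.
pose Z n := [set x | ~ U n (~` O (w x)) x].
have cO v : closed (~` O v) by exact: open_closedC.
exists Z; split=> [x|n b].
  by apply: Uout => // nO; apply: nO; exact: (wP x).1.
pose H := ~` \bigcup_(v in [set v | le v (w b) /\ v <> w b]) O v.
have cH : closed H by apply: open_closedC; apply: bigcup_open.
have Hb : H b.
  by move=> [v [vw nvw] /(wP b).2 wv]; apply: nvw; exact: le_anti.
have Nb : nbhs b (U n H) by apply: open_nbhs_nbhs; split; [exact: Uopen|exact: Usub].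
have Ob : nbhs b (O (w b)) by apply: open_nbhs_nbhs; split; [|exact: (wP b).1].
have yw y : U n H y -> O (w b) y -> Z n y -> w y = w b.
  move=> UHy /(wP y).2 wyb Zy; apply: contrapT => nw.
  apply: Zy; apply: Umono UHy => //.
  by apply: subsetC => z Oz; exists (w y).
have [Zb|/contrapT Zb] := pselect (Z n b).
  by apply: filterS (filterI Nb Ob) => y [UH Oy] Zy; split=> //; rewrite (yw y).
have Ub : nbhs b (U n (~` O (w b))) by apply: open_nbhs_nbhs; split=> //; exact: Uopen.
apply: filterS (filterI Ub (filterI Nb Ob)) => y [Uy [UH Oy]] Zy.
by have := Zy; rewrite /Z /= (yw y).
Qed.

Let g n (x : X) := U n [set x].

Local Lemma c1 (x : X) : closed [set x].
Proof. exact/accessible_closed_set1/hausdorff_accessible. Qed.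
Arguments c1 : clear implicits.

Local Lemma g_nbhs n x : nbhs x (g n x).
Proof. by apply: open_nbhs_nbhs; split; [exact/Uopen/c1|exact: (Usub n (c1 x))]. Qed.

Local Lemma g_anti m n x y : m <= n -> g n x y -> g m x y.
Proof. by move=> mn; exact: (Uanti (c1 x) mn). Qed.

Local Lemma gxx n x : g n x x. Proof. exact: nbhs_singleton (g_nbhs n x). Qed.

Lemma g_conv p A : nbhs p A -> exists n, (g n)^~ p `<=` A.
Proof.
rewrite nbhsE => -[O [oO Op] OA]; have cO := open_closedC oO.
have [|n nU] := @Uout _ p cO; first exact.
exists n => x gxp; apply: OA; apply: contrapT => Ox.
have xO : [set x] `<=` ~` O by move=> _ ->.
exact: nU (Umono (c1 x) cO xO gxp).
Qed.

(** This is the condition on compact sets, for [g]. *)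
Lemma g_compact K O : compact K -> open O -> K `<=` O ->
  exists n, forall x, K x -> g n x `<=` O.
Proof.
move=> cK oO KO; have [|n Un] := Ucompact cK (open_closedC oO).
  by rewrite disjoints_subset setCK.
exists n => x Kx y gxy; apply: contrapT => Oy.
suff : (U n K `&` ~` O) y by rewrite Un.
have xK : [set x] `<=` K by move=> _ ->.
by split=> //; exact: (Umono (c1 x) (compact_closed X2 cK) xK gxy).
Qed.

Lemma g_base p A : nbhs p A -> exists n, g n p `<=` A.
Proof.
rewrite nbhsE => -[O [oO Op] OA].
have [|n gO] := g_compact (@compact_set1 _ p) oO; first by move=> _ ->.
by exists n => y /(gO p erefl)/OA.
Qed.

(** The sequence converges to [p], but this is not stated: a filter without
    cluster point [p] misses a neighbourhood of [p], hence lives on finitely many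
    terms. *)
Lemma compact_g_seq p (y : nat -> X) N : (forall n, g n p (y n)) ->
  compact (p |` y @` [set n | N <= n]).
Proof.
move=> gy F PF FK.
have [pF|] := pselect (cluster F p); first by exists p; split=> //; left.
move=> /existsNP[A /existsNP[B /not_implyP[FA /not_implyP[/g_base[n nB] AB]]]].
have /filterI/(_ FA) := FK => FKA.
have fin : finite_set (y @` [set m | m < n]) by exact/finite_image/finite_II.
have FE : F (y @` [set m | N <= m < n]).
  apply: filterS FKA => x [[->|[m /= Nm ymx]] Ax].
    by exfalso; apply: AB; exists p; split=> //; exact/nB/gxx.
  exists m => //=; rewrite Nm ltnNge; apply/negP => nm; apply: AB; exists x.
  by split=> //; apply: nB; rewrite -ymx; apply: g_anti nm _.
have [|x [[m /andP[Nm _] ymx] Fx]] := @finite_compact _ (y @` [set m | N <= m < n]) _ F PF FE.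
  by apply: sub_finite_set fin => x [m /andP[_ mn] <-]; exists m.
by exists x; split=> //; right; exists m.
Qed.

(** If this failed, with [z n] in [g n (y n)] outside an open [O] and [y n] in
    [g n p], the compact set made of [p] and a tail of [y] would lie in [O], and so
    would [g n (y n)] for large [n]. *)
Lemma g_gamma p A : nbhs p A ->
  exists n, forall y z, g n p y -> g n y z -> A z.
Proof.
rewrite nbhsE => -[O [oO Op] OA]; apply: contrapT => /forallNP noN.
have /choice[yz yzP] n : exists q : X * X, [/\ g n p q.1, g n q.1 q.2 & ~ O q.2].
  apply: contrapT => /forallNP noyz; apply: (noN n) => y z py yz.
  by apply: OA; apply: contrapT => Oz; apply: (noyz (y, z)).
have [N NO] := g_base (open_nbhs_nbhs (conj oO Op)).
have cK := @compact_g_seq p (fun n => (yz n).1) N (fun n => let: And3 h _ _ := yzP n in h).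
have [|n nO] := g_compact cK oO.
  move=> _ [->//|[m /= Nm <-]]; apply: NO.
  by have [py _ _] := yzP m; exact: g_anti Nm _.
have [_ gz nOz] := yzP (maxn n N); apply: nOz.
apply: (nO (yz (maxn n N)).1).
  by right; exists (maxn n N) => //=; rewrite leq_maxr.
by apply: g_anti gz; rewrite leq_maxl.
Qed.

Lemma chain_g_anti m n k x y : m <= n ->
  chain g (nseq k n) x y -> chain g (nseq k m) x y.
Proof.
move=> mn; elim: k x => //= k IH x [z gz zy].
by exists z; [exact: g_anti mn _|exact: IH].
Qed.

Lemma chain_g_base k p A : nbhs p A -> exists n, chain g (nseq k n) p `<=` A.
Proof.
elim: k A => [|k IH] A pA; first by exists 0 => _ /= <-; exact: nbhs_singleton.
have [m mA] := g_gamma pA; have [n nm] := IH _ (g_nbhs m p).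
exists (maxn m n) => z; rewrite -addn1 nseqD => pz.
have [y py [w yw <-]] := chain_split pz.
apply: (mA y).
  by apply: nm; apply: chain_g_anti py; rewrite leq_maxr.
by apply: g_anti yw; rewrite leq_maxl.
Qed.

(** The covers by the sets [g n w] form a development: [g_conv] puts [w] close
    to [p], and [g_gamma] bounds [g n w]. *)
Lemma g_development p A : nbhs p A ->
  exists n, forall w, g n w p -> g n w `<=` A.
Proof.
move=> pA; have [m mA] := g_gamma pA; have [n nm] := g_conv (g_nbhs m p).
exists (maxn m n) => w wp z wz; apply: (mA w).
  by apply: nm; apply: g_anti wp; rewrite leq_maxr.
by apply: g_anti wz; rewrite leq_maxl.
Qed.

(** [S i] consists of the points [a] whose star in the [i]-th cover is inside
    [g n a].  On its closure the star is still reached in two steps: if [g i w]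
    contains [a], it also contains a point of [S i] near [a].  The class of [a] is
    given by the least [i] with [a] in [closure (S i)] and the first [w] with [a]
    in [g i w], and [D a] is [g i w]. *)
Lemma g_partition n : exists D : X -> set X,
  [/\ sigma_discrete D, forall a, nbhs a (D a)
    & forall a, D a `<=` chain g (nseq 2 n) a].
Proof.
pose S i := [set a | forall w, g i w a -> g i w `<=` g n a].
pose T i := closure (S i).
have cT i : closed (T i) by exact: closed_closure.
have Scov a : exists i, S i a by exact: g_development (g_nbhs n a).
have TD i a w : T i a -> g i w a -> g i w `<=` chain g (nseq 2 n) a.
  move=> Ta wa.
  have wan : nbhs a (g i w) by apply: open_nbhs_nbhs; split=> //; exact/Uopen/c1.
  have [b [Sb [wb ab]]] := Ta _ (filterI wan (g_nbhs n a)).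
  by move=> z /(Sb _ wb) bz; exists b => //; exists z.
have /choice[i iP] a : exists i, T i a /\ forall k, k < i -> ~ T k a.
  have exT : exists i, `[< T i a >].
    by have [i Si] := Scov a; exists i; apply/asboolP; exact: subset_closure.
  case: (ex_minnP exT) => i /asboolP Ti imin; exists i; split=> // k ki /asboolP.
  by move=> /imin; rewrite leqNgt ki.
have [le [le_min le_anti]] := well_order_min X.
have /choice[w wP] (q : nat * X) : exists w,
    g q.1 w q.2 /\ forall v, g q.1 v q.2 -> le w v.
  by have [|w gw wmin] := le_min [set w | g q.1 w q.2]; [exists q.2; exact: gxx|exists w].
exists (fun a => g (i a) (w (i a, a))); split=> [|a|a].
- apply: (@sigma_discrete_diag _ _ i (fun k a => g k (w (k, a)))).
    exact: sigma_discrete_least iP.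
  move=> k; have [|Z [Zcov Zn]] :=
      @sigma_discrete_first (g k) le (fun a => w (k, a)) _ le_anti (fun a => wP (k, a)).
    by move=> x; exact/Uopen/c1.
  exists Z; split=> // m b; apply: filterS (Zn m b) => y /= Zy Zmy.
  by have [Zb wby] := Zy Zmy; rewrite wby.
- by apply: open_nbhs_nbhs; split; [exact/Uopen/c1|exact: (wP (_, _)).1].
- by apply: TD; [exact: (iP a).1|exact: (wP (_, _)).1].
Qed.

(** The relation [V m] restricts steps by the first [m] neighbourhood maps [D k]
    and the first [m] pieces [Z k j] of each of them. *)
Lemma expansion_metrizable (R : realType) : strongly_quasi_metrizable R X.
Proof.
have /choice[D DP] := g_partition.
have /choice[Z ZP] n : exists Z : nat -> set X, (forall x, exists m, Z m x) /\
    forall m b, nbhs b [set y | Z m y -> Z m b /\ D n b = D n y].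
  by have [] := DP n.
pose V m a y := forall k j, k < m -> j < m ->
  D k a y /\ (Z k j y -> Z k j a /\ D k a = D k y).
have Dn k a : nbhs a (D k a) by have [_ + _] := DP k; apply.
have V_anti m n a b : m <= n -> V n a b -> V m a b.
  by move=> mn Vab k j km jm; apply: Vab; exact: leq_trans mn.
have VD n k a b : k < n -> V n a b -> D k a b.
  by move=> kn Vab; have [] := Vab k k kn kn.
(* Arriving in [Z k j] after three steps forces the class of the start. *)
have Vsep m k j a b c x : V m a b -> V m b c -> V m c x -> k < m -> j < m ->
    Z k j x -> Z k j a /\ D k a = D k x.
  move=> ab bc cx km jm /((cx _ _ km jm).2)[Zc <-].
  have [Zb <-] := (bc _ _ km jm).2 Zc.
  by have := (ab _ _ km jm).2; apply.
have Dxx k a : D k a a by exact: nbhs_singleton (Dn k a).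
have Vnbhs m a : nbhs a (V m a).
  pose P (p : 'I_m * 'I_m) : set X :=
    [set y | D p.1 a y /\ (Z p.1 p.2 y -> Z p.1 p.2 a /\ D p.1 a = D p.1 y)].
  have /filter_forall : forall p, nbhs a (P p).
    by move=> p; exact: filterI (Dn p.1 a) ((ZP p.1).2 p.2 a).
  by apply: filterS => y yP k j km jm; exact: (yP (Ordinal km, Ordinal jm)).
have Vxx m a : V m a a by exact: nbhs_singleton (Vnbhs m a).
apply: (@bilocal_metrizable X V) => //; last exact: hausdorff_accessible.
- move=> x A /(@chain_g_base 6)[n nA]; exists n.+1 => a b c xa ab bc; apply: nA.
  have Dg a' : D n a' `<=` chain g (nseq 2 n) a' by have [_ _] := DP n; apply.
  have xag := Dg _ _ (VD _ _ _ _ (leqnn _) xa).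
  have abg := Dg _ _ (VD _ _ _ _ (leqnn _) ab).
  have bcg := Dg _ _ (VD _ _ _ _ (leqnn _) bc).
  exact: chain_cat xag (chain_cat abg bcg).
- move=> x m; have /choice[j jP] k := (ZP k).1 x.
  (* Beyond this index the piece of [x] for each of the first [m] maps counts. *)
  exists (maxn m (\max_(k < m) (j k).+1)) => a b c ab bc cx k l km lm.
  have mle : m <= maxn m (\max_(k < m) (j k).+1) by rewrite leq_maxl.
  have kM := leq_trans km mle; have lM := leq_trans lm mle.
  have jM : j k < maxn m (\max_(k < m) (j k).+1).
    by rewrite leq_max (leq_bigmax (F := fun k : 'I_m => (j k).+1) (Ordinal km)) orbT.
  have [_ Dax] := Vsep _ _ _ _ _ _ _ ab bc cx kM jM (jP k).
  by split=> [|Zx]; [rewrite Dax|exact: (Vsep _ _ _ _ _ _ _ ab bc cx kM lM Zx)].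
- move=> x A /(@chain_g_base 2)[k kA]; have [j Zj] := (ZP k).1 x.
  exists (maxn k j).+1 => y yx; apply: kA.
  have Dg : D k x `<=` chain g (nseq 2 k) x by have [_ _] := DP k; apply.
  apply: Dg; have [||_ <-//] := Vsep _ k j _ _ _ _ (Vxx _ y) (Vxx _ y) yx _ _ Zj.
    by rewrite ltnS leq_maxl.
  by rewrite ltnS leq_maxr.
Qed.

End Expansion.

(** * Expansions from quasi-metrics *)

Section BallExpansion.
Import Order.TTheory GRing.Theory Num.Theory.
Local Open Scope ring_scope.

(** For a compact [K] disjoint from [F], a Lebesgue number is obtained by halving
    the radius of a ball around each point of [K]. *)
Lemma strongly_quasi_metrizable_expansion (R : realType) (X : topologicalType) :
  strongly_quasi_metrizable R X -> exists U, @expansion X U.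
Proof.
move=> [d [[qd dd'] opend]]; have [d0 dxy dT] := qd.
have qd' := quasi_metric_inv qd.
have ballP (A : set X) x : open A -> A x ->
    exists2 n, qm_ball d x (2^-1 ^+ n) `<=` A &
               qm_ball (qm_inv d) x (2^-1 ^+ n) `<=` A.
  rewrite opend => oA Ax; have := dd' _ oA.
  move: oA => /(qm_topologyP _ qd)/(_ x Ax)[r r0 rA].
  move=> /(qm_topologyP _ qd')/(_ x Ax)[s s0 sA].
  have [m mr] := half_expr_lt r0; have [n ns] := half_expr_lt s0.
  exists (maxn m n) => y dy; [apply: rA|apply: sA].
    by apply: lt_trans mr; apply: lt_le_trans dy _; rewrite half_expr_le// leq_maxl.
  by apply: lt_trans ns; apply: lt_le_trans dy _; rewrite half_expr_le// leq_maxr.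
have oball x r : open (qm_ball d x r).
  rewrite opend; apply/(qm_topologyP _ qd) => y xy; exists (r - d x y).
    by rewrite subr_gt0.
  by move=> z; rewrite /qm_ball /=; have := dT x y z; lra.
exists (fun n F => \bigcup_(x in F) qm_ball d x (2^-1 ^+ n)); split.
- by move=> n F _; apply: bigcup_open.
- move=> m n F _ mn y [x Fx xy]; exists x => //.
  by apply: lt_le_trans xy _; exact: half_expr_le.
- by move=> n F G _ _ FG y [x /FG Gx xy]; exists x.
- move=> F cF; apply/seteqP; split=> [x Ux|x Fx n _].
    apply: contrapT => nFx.
    have [n _ nF] := ballP _ x (closed_openC cF) nFx.
    by have [y Fy yx] := Ux n I; exact: nF yx Fy.
  by exists x => //; rewrite /qm_ball /= (dxy x x).2// half_expr_gt0.
- move=> K F /compact_near_coveringP cK cF KF.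
  suff [n _ nP] : \forall n \near \oo, K `<=` [set x | qm_ball d x (2^-1 ^+ n) `<=` ~` F].
    exists n; apply/disjoints_subset => y [x Kx xy].
    exact: (nP n (leqnn n) x Kx y xy).
  apply: cK => x Kx.
  have nFx : (~` F) x by move=> Fx; suff: (K `&` F) x by rewrite KF.
  have [n nF _] := ballP _ x (closed_openC cF) nFx.
  exists (qm_ball d x (2^-1 ^+ n.+1), [set m | (n.+1 <= m)%N]).
    split; last by exists n.+1.
    apply: open_nbhs_nbhs; split; first exact: oball.
    by rewrite /qm_ball /= (dxy x x).2// half_expr_gt0.
  move=> [x' m] [/= xx' nm] y x'y; apply: nF; move: xx' x'y.
  have := half_expr_le R nm; rewrite /qm_ball /= exprS.
  by have := dT x x' y; lra.
Qed.

End BallExpansion.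

(** * Expansions and lower semi-continuous maps *)

Section LscExpansion.
Variables (X Y : topologicalType) (B : nat -> set Y).
Hypothesis hB : strictly_increasing_closed_cover B.

Lemma cover_nondecreasing m n : m <= n -> B m `<=` B n.
Proof.
have [_ _ _ Blt] := hB.
move=> /subnK <-; elim: (n - m) => // k IH; apply: subset_trans IH _.
by rewrite addSn; have /properW := Blt (k + m).
Qed.

Lemma cover_step n : exists2 y, B n.+1 y & ~ B n y.
Proof.
have [_ _ _ Blt] := hB; have [_ /nonsubset[y [By nBy]]] := Blt n; by exists y.
Qed.

(** The intersection defining [phi F x] is [B n] for the least [n] with [x]
    outside [U n F], and all of [Y] if there is none.  A point [y] of [B k] is in
    [phi F x] iff [x] is in [U n F] for those [n] less than [k] with [y] outside
    [B n]: finitely many open conditions on [x], whence lower semi-continuity. *)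
Lemma lsc_of_expansion (U : nat -> set X -> set X) : expansion U ->
  exists phi : set X -> X -> set Y,
    [/\ set_fun [set F : set X | closed F] (lsc_maps X Y) phi,
        forall F : set X, closed F ->
          F = \bigcap_n sv_preimage (phi F) (~` B n),
        forall F1 F2 : set X, closed F1 -> closed F2 -> F1 `<=` F2 ->
          forall x, phi F1 x `<=` phi F2 x
      & forall K F : set X, compact K -> closed F -> K `&` F = set0 ->
          sv_bounded_on B (phi K) F].
Proof.
move=> [Uopen Uanti Umono Ucap Ucompact].
have [cB Bcov B0 _] := hB.
pose phi F x := \bigcap_(n in [set n | ~ U n F x]) B n.
exists phi; split.
- move=> F cF; split=> [x|V oV].
    split; last by apply: closed_bigI => n _; exact: cB.
    have [y B0y] := B0; exists y => n _; exact: cover_nondecreasing B0y.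
  rewrite openE => x [y [xy Vy]].
  have [k _ Bky] : (\bigcup_n B n) y by rewrite Bcov.
  have : nbhs x [set x' | forall n : 'I_k, ~ B n y -> U n F x'].
    apply: filter_forall => n; have [Bny|nBny] := pselect (B n y).
      by apply: filterS filterT => x' _ /(_ Bny).
    have Ux : U n F x by apply: contrapT => /xy.
    by apply: filterS (open_nbhs_nbhs (conj (Uopen n F cF) Ux)).
  apply: filterS => x' Ux'; exists y; split=> // n nUx'.
  have [kn|nk] := leqP k n; first exact: cover_nondecreasing kn _ Bky.
  by apply: contrapT => /(Ux' (Ordinal nk)).
- move=> F cF; rewrite -{1}(Ucap F cF).
  apply/seteqP; split=> x Ux n _; last first.
    have [y [xy nBy]] := Ux n I.
    by apply: contrapT => /xy.
  have [y By nBy] := cover_step n; exists y; split=> // m nUm.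
  apply: cover_nondecreasing By; rewrite ltnNge; apply/negP => mn.
  by apply: nUm; apply: (Uanti m n) => //; exact: Ux.
- move=> F G cF cG FG x y xy n nG; apply: xy => /=.
  by apply: contra_not nG; exact: Umono.
- move=> K F cK cF KF; have [n Un] := Ucompact K F cK cF KF.
  exists n => x Fx y; apply => Ux.
  by suff: (U n K `&` F) x by rewrite Un.
Qed.

Lemma expansion_of_lsc (phi : set X -> X -> set Y) :
  hausdorff_space X ->
  set_fun [set F : set X | closed F] (lsc_maps X Y) phi ->
  (forall F : set X, closed F ->
     F = \bigcap_n sv_preimage (phi F) (~` B n)) ->
  (forall F1 F2 : set X, closed F1 -> closed F2 -> F1 `<=` F2 ->
     forall x, phi F1 x `<=` phi F2 x) ->
  (forall K F : set X, compact K -> closed F -> K `&` F = set0 ->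
     sv_bounded_on B (phi K) F) ->
  expansion (fun n F => sv_preimage (phi F) (~` B n)).
Proof.
move=> X2 phi_lsc phi_cap phi_mono phi_bounded; have [cB _ _ _] := hB; split.
- by move=> n F cF; have [_] := phi_lsc F cF; apply; exact: closed_openC.
- move=> m n F cF mn x [y [xy nBy]]; exists y; split=> //.
  by apply: contra_not nBy; exact: cover_nondecreasing.
- by move=> n F G cF cG FG x [y [/(phi_mono _ _ cF cG FG) xy nBy]]; exists y.
- by move=> F /phi_cap.
- move=> K F cK cF KF; have [n Fn] := phi_bounded K F cK cF KF.
  exists n; apply/disjoints_subset => x [y [xy nBy]] Fx.
  by apply: nBy; exact: Fn xy.
Qed.

End LscExpansion.

Theorem theorem4p6 (R : realType) (X Y : topologicalType) (B : nat -> set Y)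
  (hX : hausdorff_space X) (hY : hausdorff_space Y)
  (hB : strictly_increasing_closed_cover B) :
  strongly_quasi_metrizable R X <->
  exists phi : set X -> X -> set Y,
    [/\ set_fun [set F : set X | closed F] (lsc_maps X Y) phi,
        forall F : set X, closed F ->
          F = \bigcap_n sv_preimage (phi F) (~` B n),
        forall F1 F2 : set X, closed F1 -> closed F2 -> F1 `<=` F2 ->
          forall x, phi F1 x `<=` phi F2 x
      & forall K F : set X, compact K -> closed F -> K `&` F = set0 ->
          sv_bounded_on B (phi K) F].
Proof.
split=> [/strongly_quasi_metrizable_expansion[U Uexp]|[phi [lsc cap mono bnd]]].
  exact: lsc_of_expansion Uexp.
exact: expansion_metrizable (expansion_of_lsc hB _ lsc cap mono bnd) R.
Qed.
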